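(* Let $\gamma=(1+\sqrt5)/2$ be the golden ratio. For each $n$, place $t$ indistinguishable pebbles on the vertices of the complete graph $K_n$ according to the Bose Einstein scheme. Let $\varphi(n)\to\infty$ be arbitrary. If $t=\gamma n+\varphi(n)\sqrt n$, then $\mathbb{P}(K_n \text{ is cover solvable})\to 1$ as $n\to\infty$; and if $t=\gamma n-\varphi(n)\sqrt n$, then $\mathbb{P}(K_n \text{ is cover solvable})\to 0$ as $n\to\infty$.
   Context: A configuration on a graph $G$ is a function $C:V(G)\to\mathbb{N}\cup\{0\}$ giving the number of pebbles on each vertex. A pebbling move removes two pebbles from some vertex and places one pebble on an adjacent vertex. A configuration is cover solvable if some finite sequence of (legal) pebbling moves results in at least one pebble on every vertex simultaneously; ''$K_n$ is cover solvable'' means the random configuration is cover solvable. In the Bose Einstein scheme the pebbles are indistinguishable and each of the $\binom{n+t-1}{n-1}$ configurations of $t$ pebbles on the $n$ vertices is equally likely. *)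

(* Defs.v *)
From HB Require Import structures.
From mathcomp Require Import all_boot all_order all_algebra.
From mathcomp Require Import all_classical all_reals all_analysis.

Set Implicit Arguments.
Unset Strict Implicit.
Unset Printing Implicit Defensive.

Import Order.TTheory GRing.Theory Num.Theory.
Import numFieldNormedType.Exports.

Section Pebbling.
Variable V : finType.

Definition config := {ffun V -> nat}.

(* In the graph with adjacency relation [e] (irreflexive, as graphs are
   simple, so that [u] and [v] below are distinct). *)
Definition pebbling_move (e : rel V) (C D : config) : bool :=
  [exists u, exists v,
    [&& e u v, 2 <= C u
      & D == [ffun w => if w == u then C w - 2
                        else if w == v then C w + 1 else C w]]].

Definition covered (C : config) : bool := [forall v, 0 < C v].

Definition cover_solvable (e : rel V) (C : config) : Prop :=
  exists2 s : seq config, path (pebbling_move e) C s & covered (last C s).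

(* No vertex carries more than [t] of the [t] pebbles, so that the
   configurations of [t] pebbles form a finite set once the counts are taken
   in ['I_t.+1]. *)
Definition configs (t : nat) : {set {ffun V -> 'I_t.+1}} :=
  [set C : {ffun V -> 'I_t.+1} | \sum_v C v == t].

Definition config_of t (C : {ffun V -> 'I_t.+1}) : config :=
  [ffun v => nat_of_ord (C v)].

(* Bose Einstein probability of the event [E]: uniform over [configs t]. *)
Definition bose_einstein_prob (R : realType) (t : nat) (E : config -> Prop)
    : R :=
  (#|[set C in configs t | `[< E (config_of C) >]]|%:R / #|configs t|%:R)%R.

End Pebbling.

Definition complete_graph (n : nat) : rel 'I_n := fun u v => u != v.

Definition golden_ratio (R : realType) : R := ((1 + Num.sqrt 5) / 2)%R.

Definition prob_cover_solvable (R : realType) (n t : nat) : R :=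
  bose_einstein_prob R t (cover_solvable (@complete_graph n)).

Lemma config_of_inj (V : finType) t : injective (@config_of V t).
Proof.
move=> C D /ffunP CD; apply/ffunP => v; apply: val_inj.
by have := CD v; rewrite !ffunE.
Qed.

Lemma config_of_configs (V : finType) t (C : config V) :
  (\sum_v C v = t)%N <-> exists2 D, D \in configs V t & C = config_of D.
Proof.
split=> [Ct|[D]]; last first.
  by rewrite inE => /eqP Dt ->; rewrite -[RHS]Dt; apply: eq_bigr => v _; rewrite ffunE.
have Cv v : C v < t.+1 by rewrite ltnS -Ct (bigD1 v) //= leq_addr.
exists [ffun v => Ordinal (Cv v)].
  by rewrite inE; apply/eqP; rewrite -[RHS]Ct; apply: eq_bigr => v _; rewrite ffunE.
by apply/ffunP => v; rewrite !ffunE.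
Qed.

Lemma card_configs n t :
  0 < n -> #|configs 'I_n t| = 'C(n + t - 1, n - 1).
Proof.
case: n => // n _; rewrite addSn !subn1 /= -card_ord_partitions.
pose f (s : n.+1.-tuple 'I_t.+1) : {ffun 'I_n.+1 -> 'I_t.+1} := [ffun i => tnth s i].
have f_inj : injective f.
  move=> s s' /ffunP ss'; apply: eq_from_tnth => i.
  by have := ss' i; rewrite !ffunE.
rewrite -(card_imset _ f_inj); apply: eq_card => C; apply/idP/imsetP.
  rewrite inE => Ct; exists [tuple C i | i < n.+1].
    by rewrite inE big_tuple; under eq_bigr do rewrite tnth_mktuple.
  by apply/ffunP => i; rewrite ffunE tnth_mktuple.
case=> s; rewrite !inE big_tuple => st ->.
by under eq_bigr do rewrite ffunE.
Qed.

(* Main.v *)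
Require Import Defs.
From mathcomp Require Import all_boot all_order all_algebra.
From mathcomp Require Import all_classical all_reals all_analysis.
From mathcomp Require Import zify ring lra.
Import Order.TTheory GRing.Theory Num.Theory.
Import numFieldNormedType.Exports.

(* On K_n, a vertex with c > 0 pebbles can send (c - 1) / 2 (rounded down) of
   them elsewhere, so a configuration of t pebbles is cover solvable iff
   2 n <= t + O, where O is the number of vertices with an odd count.
   Halving the counts shows that 'C(n, k) * 'C(n + m - 1, n - 1) configurations
   have O = k, with t = k + 2 m.  Comparing k with k + 2 makes the law of O the
   stationary law of a birth and death chain whose drift at k is, up to lower
   order terms, linear in a - k for a = t n / (n + 2 t).  Testing stationarity
   against (k - a)^2 gives E (O - a)^2 <= 5 n for all t, and Chebyshev's
   inequality concludes, since a crosses 2 n - t at t = gamma n. *)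

(** * Cover solvability on the complete graph *)

Section Solvability.
Local Open Scope nat_scope.

(** Half of the term at [v] is the number of vertices that the pebbles of [v] can cover: one pebble
    stays, and each further pair sends one away. *)
Definition potential {n} (C : config 'I_n) := \sum_v (C v + odd (C v)).

(** The term of the source drops by exactly 2, while that of the target rises by 2 if its count was
    even and by 0 if it was odd. *)
Lemma move_potential {n} {C D : config 'I_n} :
  pebbling_move (@complete_graph n) C D -> potential D <= potential C.
Proof.
case/existsP => u /existsP[v /and3P[uv Cu /eqP ->]].
have vu : v != u by rewrite eq_sym.
rewrite /potential (bigD1 u) //= (bigD1 v) //= [X in _ <= X](bigD1 u) //=.
rewrite [X in _ <= _ + X](bigD1 v) //= !ffunE eqxx (negPf vu) eqxx.
rewrite (eq_bigr (fun w => C w + odd (C w))); last first.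
  by move=> w /andP[wu wv]; rewrite ffunE (negPf wu) (negPf wv).
rewrite oddB // oddD /= addbF addbT !addnA leq_add2r.
by move: (C u) (C v) Cu => a b; case: (odd a); case: (odd b) => /=; lia.
Qed.

Lemma covered_potential {n} {C : config 'I_n} :
  covered C -> 2 * n <= potential C.
Proof.
move=> /forallP C0; rewrite -[n in 2 * n]card_ord mulnC -sum_nat_const.
by apply: leq_sum => v _; have := C0 v; case: (C v) => [|[|c]].
Qed.

(** For the converse, induct on the number of empty vertices: a move from a vertex with at least 3
    pebbles to an empty one keeps the potential and leaves the source occupied. *)
Lemma cover_solvable_complete {n} (C : config 'I_n) :
  cover_solvable (@complete_graph n) C <-> 2 * n <= potential C.
Proof.
split=> [[s sC cov]|].
  apply: leq_trans (covered_potential cov) _.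
  elim: s C sC {cov} => //= D s IHs C /andP[CD sD].
  exact: leq_trans (IHs _ sD) (move_potential CD).
have [k] := ubnP #|[set v | C v == 0]|; elim: k C => // k IHk C zC potC.
have [cov|] := boolP (covered C); first by exists [::].
rewrite negb_forall => /existsP[v]; rewrite -eqn0Ngt => /eqP Cv.
(* Otherwise every term is at most 2 and the term of [v] is 0, so the potential is below [2 * n]. *)
have [u Cu] : exists u, 2 < C u.
  apply/existsP; rewrite -[X in is_true X]negbK negb_exists; apply/negP.
  move=> /forallP C2; suff: potential C < 2 * n by rewrite ltnNge potC.
  rewrite -[n in 2 * n]card_ord mulnC -sum_nat_const /potential.
  rewrite (bigD1 v) //= [X in _ < X](bigD1 v) //= Cv add0n.
  apply: (@leq_ltn_trans (\sum_(i < n | i != v) 2)); last first.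
    by rewrite -[X in X < _]add0n ltn_add2r.
  by apply: leq_sum => w _; have := C2 w; case: (C w) => [|[|[|c]]].
have vu : v != u by apply: contraTneq Cu => <-; rewrite Cv.
set D : config 'I_n :=
  [ffun w => if w == u then C w - 2 else if w == v then C w + 1 else C w].
have CD : pebbling_move (@complete_graph n) C D.
  apply/existsP; exists u; apply/existsP; exists v.
  by rewrite eqxx andbT (ltnW Cu) /complete_graph eq_sym vu.
have [||s sD cov] := IHk D; last by exists (D :: s) => //=; rewrite CD.
- rewrite -ltnS; apply: leq_trans zC; rewrite ltnS.
  apply: proper_card; apply/properP; split.
    apply/fintype.subsetP => w; rewrite !inE ffunE; have [->|_] := eqVneq w u.
      by rewrite subn_eq0 leqNgt Cu.
    by have [->|//] := eqVneq w v; rewrite Cv.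
  by exists v; rewrite inE ?Cv // ffunE (negPf vu) eqxx Cv.
apply: leq_trans potC _.
rewrite /potential (bigD1 u) //= (bigD1 v) //= [X in _ <= X](bigD1 u) //=.
rewrite [X in _ <= _ + X](bigD1 v) //= !ffunE eqxx (negPf vu) eqxx Cv.
rewrite [X in _ <= _ + (_ + X)](eq_bigr (fun w => C w + odd (C w))); last first.
  by move=> w /andP[wu wv]; rewrite ffunE (negPf wu) (negPf wv).
have shift a b : 2 < a -> a + odd a + b <= a - 2 + odd (a - 2) + (2 + b).
  by move=> a2; rewrite oddB ?(ltnW a2) //= addbF; lia.
exact: shift.
Qed.

End Solvability.

(** * Counting configurations by their number of odd vertices *)

Section Counting.
Local Open Scope nat_scope.

Definition odd_count {n t} (C : {ffun 'I_n -> 'I_t.+1}) := \sum_v odd (C v).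

Lemma odd_count_set n t (C : {ffun 'I_n -> 'I_t.+1}) :
  odd_count C = #|[set v | odd (C v)]|.
Proof.
rewrite /odd_count -sum1dep_card [RHS]big_mkcond.
by apply: eq_bigr => v _; case: odd.
Qed.

Lemma odd_count_le n t (C : {ffun 'I_n -> 'I_t.+1}) : odd_count C <= n.
Proof. by rewrite odd_count_set -[X in _ <= X]card_ord max_card. Qed.

Lemma configs_odd_half {n t} {C : {ffun 'I_n -> 'I_t.+1}} :
  C \in configs 'I_n t ->
  t = odd_count C + 2 * \sum_v (C v)./2.
Proof.
rewrite inE => /eqP {1}<-; rewrite big_distrr -big_split /=.
by apply: eq_bigr => v _; rewrite mul2n odd_double_half.
Qed.

Lemma solvable_odd_count {n t} (C : {ffun 'I_n -> 'I_t.+1}) :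
  C \in configs 'I_n t ->
  cover_solvable (@complete_graph n) (config_of C) <-> 2 * n <= t + odd_count C.
Proof.
rewrite inE => /eqP Ct; rewrite cover_solvable_complete /potential.
rewrite (eq_bigr (fun v => C v + odd (C v))) => [|v _]; last by rewrite ffunE.
by rewrite big_split /= Ct.
Qed.

Definition odd_card n t k := #|[set C in configs 'I_n t | odd_count C == k]|.

Lemma odd_card0 n t k : ~~ ((k <= t) && (odd t == odd k)) -> odd_card n t k = 0.
Proof.
move=> kt; apply/eqP; rewrite cards_eq0; apply/eqP/setP => C; rewrite !inE.
apply/negP => /andP[Ct /eqP Ck]; move: kt.
have : C \in configs 'I_n t by rewrite inE.
move=> /configs_odd_half ->.
by rewrite Ck leq_addr oddD oddM /= addbF eqxx.
Qed.

Lemma odd_double_inj {a b : bool} {x y} :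
  a + 2 * x = b + 2 * y -> a = b /\ x = y.
Proof. by case: a; case: b => /= xy; split=> //; lia. Qed.

(** A configuration amounts to its set of odd vertices together with its halved counts, which form a
    configuration of [m] pebbles. *)
Lemma odd_cardE n k m : odd_card n (k + 2 * m) k = 'C(n, k) * #|configs 'I_n m|.
Proof.
set t := k + 2 * m.
rewrite -[n in 'C(n, _)]card_ord -card_draws -cardsX /odd_card.
pose f (p : {set 'I_n} * {ffun 'I_n -> 'I_m.+1}) : {ffun 'I_n -> 'I_t.+1} :=
  [ffun v => inord ((v \in p.1) + 2 * p.2 v)].
set A := [set B : {set 'I_n} | _].
(* On these pairs the value is at most [k + 2 * m], so [inord] does not fall back to its default. *)
have fE p v : p \in finset.setX A (configs 'I_n m) ->
    f p v = (v \in p.1) + 2 * p.2 v :> nat.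
  rewrite inE => /andP[]; rewrite inE => /eqP pk _.
  rewrite ffunE inordK // ltnS leq_add // ?leq_mul2l; last by rewrite /= -ltnS.
  case: (boolP (v \in p.1)) => // vp; rewrite -pk card_gt0.
  by apply/set0Pn; exists v.
have f_inj : {in finset.setX A (configs 'I_n m) &, injective f}.
  move=> p q pP qP /ffunP pq.
  have {}pq v : (v \in p.1) + 2 * p.2 v = (v \in q.1) + 2 * q.2 v.
    by rewrite -!fE // pq.
  case: p q pq {pP qP} => [S D] [S' D'] /= pq; congr pair.
    by apply/setP => v; have [] := odd_double_inj (pq v).
  by apply/ffunP => v; apply: val_inj; have [] := odd_double_inj (pq v).
rewrite -(card_in_imset f_inj); apply: eq_card => C; apply/idP/imsetP.
  rewrite inE => /andP[CP /eqP Ck].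
  have Ct := configs_odd_half CP.
  have halfm : \sum_v (C v)./2 = m.
    by move: Ct; rewrite Ck => /addnI/eqP; rewrite eqn_pmul2l // => /eqP.
  have Cm v : (C v)./2 < m.+1 by rewrite ltnS -halfm (bigD1 v) //= leq_addr.
  pose p := ([set v | odd (C v)],
    [ffun v => Ordinal (Cm v)] : {ffun 'I_n -> 'I_m.+1}).
  have pP : p \in finset.setX A (configs 'I_n m).
    rewrite !inE /= -odd_count_set Ck eqxx /=.
    by rewrite (eq_bigr (fun v => (C v)./2)) ?halfm // => v _; rewrite ffunE.
  exists p => //; apply/ffunP => v; apply: val_inj.
  by rewrite /= fE //= inE ffunE /= mul2n odd_double_half.
case=> p pP ->; have [pA pm] : p.1 \in A /\ \sum_v p.2 v = m.
  by move: pP; rewrite inE => /andP[pA]; rewrite inE => /eqP.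
have pk : \sum_v (v \in p.1) = k.
  move: pA; rewrite inE => /eqP <-; rewrite -sum1_card [RHS]big_mkcond.
  by apply: eq_bigr => v _; case: (v \in _).
rewrite !inE /odd_count; apply/andP; split.
  rewrite (eq_bigr (fun v => (v \in p.1) + 2 * p.2 v)); last first.
    by move=> v _; exact: fE.
  by rewrite big_split -big_distrr /= pm pk.
rewrite (eq_bigr (fun v => (v \in p.1) : nat)) ?pk // => v _.
by rewrite fE // oddD oddM /= addbF oddb.
Qed.

Lemma card_configsS n m : 0 < n ->
  m.+1 * #|configs 'I_n m.+1| = (n + m) * #|configs 'I_n m|.
Proof.
move=> n0; rewrite !card_configs //; case: n n0 => // n _.
rewrite !subn1 !addSn addnS /=.
rewrite -[in 'C((n + m).+1, n)]bin_sub; last by lia.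
rewrite -[in 'C(n + m, n)]bin_sub ?leq_addr //.
have -> : (n + m).+1 - n = m.+1 by lia.
by rewrite addKn mul_bin_diag.
Qed.

(** Detailed balance between [k] and [k.+2], obtained from the ratios of consecutive factors in
    [odd_cardE]. Both sides vanish when [k] exceeds [t] or has the other parity. *)
Lemma odd_card_balance n t k : 0 < n ->
  (n - k) * (n - k.+1) * (t - k) * odd_card n t k =
  k.+2 * k.+1 * (2 * n + t - k.+2) * odd_card n t k.+2.
Proof.
move=> n0.
have [/andP[kt /eqP otk]|kt] := boolP ((k <= t) && (odd t == odd k));
  last first.
  rewrite odd_card0 // muln0 odd_card0 ?muln0 //; apply: contra kt.
  by rewrite /= negbK => /andP[kt ->]; rewrite andbT; lia.
have -> : t = k + 2 * (t - k)./2.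
  by rewrite mul2n even_halfK ?oddB ?otk ?addbb // subnKC.
case: (t - k)./2 => [|m].
  rewrite muln0 addn0 subnn muln0 mul0n.
  by rewrite [odd_card _ _ k.+2]odd_card0 ?muln0 // ltnNge leqW.
rewrite odd_cardE (_ : k + 2 * m.+1 = k.+2 + 2 * m) ?odd_cardE; last by lia.
have -> : k.+2 + 2 * m - k = 2 * m.+1 by lia.
have -> : 2 * n + (k.+2 + 2 * m) - k.+2 = 2 * (n + m) by lia.
have e1 := mul_bin_left n k; have e2 := mul_bin_left n k.+1.
have e3 := card_configsS n m n0.
transitivity
  (2 * ((n - k.+1) * ((n - k) * 'C(n, k))) * (m.+1 * #|configs 'I_n m.+1|)).
  lia.
rewrite -e1 e3 (mulnCA (n - k.+1)) -e2; lia.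
Qed.

End Counting.

(** * Second moment of the number of odd vertices *)

Section Concentration.
Variable R : realType.
Local Open Scope ring_scope.

Lemma odd_card_balanceR n t k : (k.+2 <= n)%N ->
  (n%:R - k%:R) * (n%:R - k%:R - 1) * (t%:R - k%:R) * (odd_card n t k)%:R =
  k.+2%:R * (k.+2%:R - 1) * (2 * n%:R + t%:R - k.+2%:R)
    * (odd_card n t k.+2)%:R :> R.
Proof.
move=> kn; have [tk|kt] := ltnP t k.
  by rewrite !odd_card0 ?mulr0 // negb_and -ltnNge ?tk // (ltn_trans tk).
have n0 : (0 < n)%N by exact: leq_trans kn.
have /(congr1 (fun m : nat => m%:R : R)) := odd_card_balance n t k n0.
have [kn1 kn2 kn3] : [/\ k <= n, k < n & k.+2 <= 2 * n + t]%N by split; lia.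
rewrite !natrM !natrB // natrD natrM.
by move=> e; apply: etrans (etrans e _); rewrite -!natr1; ring.
Qed.

Lemma sum_odd_count n t (f : nat -> R) :
  \sum_(C in configs 'I_n t) f (odd_count C) =
  \sum_(k < n.+1) (odd_card n t k)%:R * f k.
Proof.
pose o (C : {ffun 'I_n -> 'I_t.+1}) : 'I_n.+1 :=
  Ordinal (odd_count_le _ _ C : _ < n.+1)%N.
rewrite (partition_big o xpredT) //=; apply: eq_bigr => k _.
rewrite (eq_bigr (fun=> f k)) => [|C /andP[_ /eqP <-]//].
rewrite sumr_const mulr_natl; congr (_ *+ _); apply: eq_card => C.
by rewrite [RHS]inE.
Qed.

(* [odd_card n t] is a stationary weight of a birth and death chain with jumps
   of size 2; below is the sum of its generator, divided by 4, at the test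
   function [(x - a) ^+ 2]. *)
Lemma odd_card_stationary n t (a : R) : (1 < n)%N ->
  \sum_(k < n.+1) (odd_card n t k)%:R *
    ((n%:R - k%:R) * (n%:R - k%:R - 1) * (t%:R - k%:R) * (k%:R + 1 - a)
     - k%:R * (k%:R - 1) * (2 * n%:R + t%:R - k%:R) * (k%:R - 1 - a)) = 0.
Proof.
case: n => [|[|n]] // _; under eq_bigr do rewrite mulrBr; rewrite sumrB.
apply/eqP; rewrite subr_eq0; apply/eqP.
(* The last two upward terms and the first two downward terms vanish; the upward term at [k] then
   matches the downward term at [k + 2]. *)
rewrite [LHS]big_ord_recr [X in X + _ = _]big_ord_recr.
rewrite [RHS]big_ord_recl [X in _ = _ + X]big_ord_recl /=.
rewrite !subrr !(mul0r, mulr0, addr0, add0r).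
rewrite -(natr1 n.+1) [_ + 1 - n.+1%:R]addrAC subrr add0r subrr.
rewrite !(mul0r, mulr0, addr0).
apply: eq_bigr => k _; rewrite /bump /= !add1n.
transitivity ((n.+2%:R - k%:R) * (n.+2%:R - k%:R - 1) * (t%:R - k%:R)
   * (odd_card n.+2 t k)%:R * (k%:R + 1 - a)); first by rewrite -!natr1; ring.
by rewrite (odd_card_balanceR n.+2 t k (ltn_ord k)) -!natr1; ring.
Qed.

(** By the choice of [a], the up rate minus the down rate is [(n - 1) * (n + 2 * t) * (a - x) + 2 *
    x * (n - x)]. Its main part cancels the square, and the rest is at most
    [n ^+ 2 * (5 / 2 * n + t)]. *)
Lemma generator_bound {n t x a : R} :
  2 <= n -> 0 <= t -> 0 <= x <= n -> x <= t ->
  0 <= a <= n -> a * (n + 2 * t) = t * n ->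
  (n - 1) * (n + 2 * t) * (x - a) ^+ 2 +
    ((n - x) * (n - x - 1) * (t - x) * (x + 1 - a)
     - x * (x - 1) * (2 * n + t - x) * (x - 1 - a))
  <= (n - 1) * (n + 2 * t) * (5 * n).
Proof.
move=> n2 t0 /andP[x0 xn] xt /andP[a0 an] aE.
have -> : (n - 1) * (n + 2 * t) * (x - a) ^+ 2 +
    ((n - x) * (n - x - 1) * (t - x) * (x + 1 - a)
     - x * (x - 1) * (2 * n + t - x) * (x - 1 - a)) =
  2 * (x * (n - x)) * (x - a) + (n - x) * (n - x - 1) * (t - x)
   + x * (x - 1) * (2 * n + t - x)
   + (t * n - a * (n + 2 * t)) * (n - 1) * (x - a).
  by ring.
rewrite aE subrr !mul0r addr0.
have nx : 0 <= n - x by rewrite subr_ge0.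
have tx : 0 <= t - x by rewrite subr_ge0.
have b : (n - x) * (n - x - 1) * (t - x) <= (n - x) ^+ 2 * t.
  have : 0 <= (n - x) * (t - x) by exact: mulr_ge0.
  have : 0 <= (n - x) ^+ 2 * x by rewrite mulr_ge0 // sqr_ge0.
  nra.
have d : x * (x - 1) * (2 * n + t - x) <= x ^+ 2 * (2 * n + t).
  have : 0 <= x * (2 * n + t - x) by apply: mulr_ge0 => //; lra.
  have : 0 <= x ^+ 2 * x by rewrite mulr_ge0 // sqr_ge0.
  nra.
have e : 2 * (x * (n - x)) * (x - a) <= n ^+ 2 / 2 * n.
  have xnx : 0 <= 2 * (x * (n - x)) by rewrite !mulr_ge0.
  have : 2 * (x * (n - x)) <= n ^+ 2 / 2 by have := sqr_ge0 (n - 2 * x); nra.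
  have : 0 <= n - (x - a) by lra.
  nra.
have c : (n - x) ^+ 2 * t + x ^+ 2 * (2 * n + t) <= n ^+ 2 * (2 * n + t).
  have : (n - x) ^+ 2 + x ^+ 2 <= n ^+ 2 by nra.
  have : 0 <= (n - x) ^+ 2 * n by rewrite mulr_ge0 ?sqr_ge0 //; lra.
  nra.
(* As [2 <= n], one factor [n] is at most [2 * (n - 1)]; doubling 5 / 2 gives the constant 5. *)
have : n * (n * (5 / 2 * n + t)) <= n * (2 * (n - 1) * (5 / 2 * n + t)).
  apply: ler_wpM2l; first by lra.
  by apply: ler_wpM2r; lra.
have : 0 <= n * ((n - 1) * t) by rewrite !mulr_ge0 //; lra.
nra.
Qed.

Lemma odd_count_variance n t (a : R) : (1 < n)%N ->
  a * (n%:R + 2 * t%:R) = t%:R * n%:R ->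
  \sum_(C in configs 'I_n t) ((odd_count C)%:R - a) ^+ 2
    <= 5 * n%:R * #|configs 'I_n t|%:R.
Proof.
move=> n1 aE; have n2 : 2 <= n%:R :> R by rewrite ler_nat.
have t0 : 0 <= t%:R :> R by exact: ler0n.
have nt : 0 < (n%:R + 2 * t%:R : R) by lra.
have a0n : (0 : R) <= a <= n%:R.
  apply/andP; split; first by rewrite -(pmulr_lge0 _ nt) aE mulr_ge0.
  by rewrite -(ler_pM2r nt) aE; nra.
have -> : #|configs 'I_n t|%:R = \sum_(C in configs 'I_n t) 1 :> R.
  by rewrite sumr_const.
rewrite (sum_odd_count _ _ (fun k => (k%:R - a) ^+ 2)).
rewrite (sum_odd_count _ _ (fun=> 1)).
have c0 : 0 < (n%:R - 1) * (n%:R + 2 * t%:R) :> R by apply: mulr_gt0 => //; lra.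
(* The added 0 becomes the stationarity sum, so that [generator_bound] applies term by term. *)
rewrite -(ler_pM2l c0) -[leLHS]addr0.
rewrite -[X in _ + X <= _](odd_card_stationary n t a n1).
rewrite !mulr_sumr -big_split /=; apply: ler_sum => k _.
have [tk|kt] := ltnP t k.
  by rewrite odd_card0 ?mul0r ?mulr0 ?addr0 // negb_and -ltnNge tk.
rewrite mulr1 mulrCA -mulrDr [leRHS]mulrA [leRHS]mulrC ler_wpM2l //.
have kn : (0 <= k%:R :> R) && (k%:R <= n%:R :> R).
  by rewrite ler0n ler_nat -ltnS ltn_ord.
have ktR : k%:R <= t%:R :> R by rewrite ler_nat.
exact: generator_bound n2 t0 kn ktR a0n aE.
Qed.

Lemma bose_einstein_tail n t (a D : R) (E : config 'I_n -> Prop) : (1 < n)%N ->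
  a * (n%:R + 2 * t%:R) = t%:R * n%:R -> 0 <= D ->
  (forall C, C \in configs 'I_n t -> E (config_of C) ->
    D <= `|(odd_count C)%:R - a|) ->
  D ^+ 2 * bose_einstein_prob R t E <= 5 * n%:R.
Proof.
move=> n1 aE D0 ED; rewrite /bose_einstein_prob.
set B := [set C in _ | _].
have T0 : 0 < #|configs 'I_n t|%:R :> R.
  by rewrite ltr0n card_configs ?bin_gt0; lia.
rewrite mulrA ler_pdivrMr //; apply: le_trans (odd_count_variance n t a n1 aE).
rewrite mulrC mulr_natl -sumr_const [leLHS]big_mkcond [leRHS]big_mkcond /=.
apply: ler_sum => C _; rewrite inE; case: (boolP (C \in configs _ _)) => //= CT.
case: asboolP => [EC|_]; last exact: sqr_ge0.
by rewrite -[leRHS]real_normK ?num_real // lerXn2r ?nnegrE // ED.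
Qed.

Lemma bose_einstein_probN n t (E : config 'I_n -> Prop) : (0 < n)%N ->
  bose_einstein_prob R t (fun C => ~ E C) = 1 - bose_einstein_prob R t E.
Proof.
move=> n0; have T0 : #|configs 'I_n t|%:R != 0 :> R.
  by rewrite pnatr_eq0 -lt0n card_configs ?bin_gt0 //; lia.
rewrite /bose_einstein_prob -[X in X - _](divff T0) -mulrBl; congr (_ / _).
apply/eqP; rewrite eq_sym subr_eq -natrD eqr_nat; apply/eqP.
rewrite -(cardsID [set C | `[< E (config_of C) >]] (configs 'I_n t)) addnC.
by congr addn; apply: eq_card => C; rewrite !inE ?asbool_neg // andbC.
Qed.

(** * The golden ratio threshold and the limits *)

Lemma golden_ratio_sqr : golden_ratio R ^+ 2 = golden_ratio R + 1.
Proof.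
have := sqr_sqrtr (ler0n R 5); rewrite /golden_ratio.
by move: (Num.sqrt _) => s s5; lra.
Qed.

(** Gives the sign of the factor [2 * g - 3] in [solvable_deviation]. *)
Lemma golden_ratio_ge : 3 / 2 <= golden_ratio R.
Proof.
suff : 2 <= Num.sqrt 5 :> R by rewrite /golden_ratio; lra.
by rewrite -[2]ger0_norm // -sqrtr_sqr ler_sqrt; lra.
Qed.

End Concentration.

Local Open Scope classical_set_scope.
Local Open Scope ring_scope.

(* [2 - gamma] is [mu / (1 + 2 mu)] at [mu = gamma], the limiting proportion of
   odd vertices at density [gamma]. *)
Lemma solvable_deviation (R : realType) (n t : nat) (a D : R)
    (C : {ffun 'I_n -> 'I_t.+1}) :
  (0 < n)%N -> a * (n%:R + 2 * t%:R) = t%:R * n%:R -> 0 <= D ->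
  C \in configs 'I_n t ->
  (t%:R = golden_ratio R * n%:R + D ->
     ~ cover_solvable (@complete_graph n) (config_of C) ->
     D <= `|(odd_count C)%:R - a|) /\
  (t%:R = golden_ratio R * n%:R - D ->
     cover_solvable (@complete_graph n) (config_of C) ->
     D <= `|(odd_count C)%:R - a|).
Proof.
move=> n0 aE D0 CT; rewrite (solvable_odd_count _ CT).
set o := odd_count C; set g := golden_ratio R.
have g2 : g ^+ 2 = g + 1 := golden_ratio_sqr R.
have g1 : 3 / 2 <= g := golden_ratio_ge R.
have n0R : 0 < n%:R :> R by rewrite ltr0n.
have t0 : 0 <= t%:R :> R by exact: ler0n.
have nt : 0 < (n%:R + 2 * t%:R : R) by lra.
have agap : (a - (2 - g) * n%:R) * (n%:R + 2 * t%:R)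
    = n%:R * (2 * g - 3) * (t%:R - g * n%:R).
  by rewrite mulrBl aE; ring: g2.
split=> tE.
  (* Here [o < 2 * n - t = (2 - g) * n - D <= a - D]; the other case is the mirror image. *)
  move=> /negP; rewrite -ltnNge -(ltr_nat R) natrD natrM => o2.
  have age : (2 - g) * n%:R <= a.
    rewrite -subr_ge0 -(pmulr_lge0 _ nt) agap tE addrAC subrr add0r.
    by rewrite !mulr_ge0 //; lra.
  by rewrite distrC; apply: le_trans (ler_norm _); lra.
rewrite -(ler_nat R) natrD natrM => o2.
have age : a <= (2 - g) * n%:R.
  rewrite -subr_ge0 -(pmulr_lge0 _ nt) -opprB mulNr agap tE addrAC subrr add0r.
  by rewrite mulrN opprK !mulr_ge0 //; lra.
by apply: le_trans (ler_norm _); lra.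
Qed.

Lemma cvg_inv_sqr {R : realType} {phi p : nat -> R} {l : R} :
  phi n @[n --> \oo] --> +oo ->
  (forall n, (1 < n)%N -> 0 < phi n -> phi n ^+ 2 * `|l - p n| <= 5) ->
  p n @[n --> \oo] --> l.
Proof.
move=> phioo pphi; apply/cvgrPdist_lt => e e0.
(* Beyond this threshold [phi n] exceeds both 1 and [5 / e], hence [phi n ^+ 2 * e > 5]. *)
have phige := (cvgryPge _).1 phioo (5 / e + 1).
near=> n.
have n1 : (1 < n)%N by near: n; exact: nbhs_infty_gt.
have pn : 5 / e + 1 <= phi n by near: n; exact: phige.
have e5 : 0 < 5 / e by rewrite divr_gt0.
have phi0 : 0 < phi n by lra.
have := pphi n n1 phi0; apply: contraTT; rewrite -leNgt -ltNge => ep.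
have -> : 5 = 5 / e * e :> R by rewrite divfK // gt_eqF.
apply: (@lt_le_trans _ _ (phi n ^+ 2 * e)); last by rewrite ler_wpM2l ?sqr_ge0.
by rewrite ltr_pM2r //; nra.
Unshelve. all: by end_near. Qed.

Theorem theorem6 (R : realType) (phi : nat -> R) (t : nat -> nat)
    (phi_pinfty : phi n @[n --> \oo] --> +oo) :
  ((forall n : nat, (0 < n)%N ->
      (t n)%:R = golden_ratio R * n%:R + phi n * Num.sqrt n%:R) ->
    prob_cover_solvable R n (t n) @[n --> \oo] --> (1 : R))
  /\
  ((forall n : nat, (0 < n)%N ->
      (t n)%:R = golden_ratio R * n%:R - phi n * Num.sqrt n%:R) ->
    prob_cover_solvable R n (t n) @[n --> \oo] --> (0 : R)).
Proof.
have be_ge0 n m (E : config 'I_n -> Prop) : 0 <= bose_einstein_prob R m E.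
  by rewrite divr_ge0.
have tail n (E : config 'I_n -> Prop) : (1 < n)%N -> 0 < phi n ->
    (forall (a : R) C, a * (n%:R + 2 * (t n)%:R) = (t n)%:R * n%:R ->
      0 <= phi n * Num.sqrt n%:R ->
      C \in configs 'I_n (t n) -> E (config_of C) ->
      phi n * Num.sqrt n%:R <= `|(odd_count C)%:R - a|) ->
    phi n ^+ 2 * bose_einstein_prob R (t n) E <= 5.
  move=> n1 phi0 dev; have n0 : 0 < n%:R :> R by rewrite ltr0n ltnW.
  have nt : n%:R + 2 * (t n)%:R != 0 :> R.
    by rewrite gt_eqF // ltr_pwDl // mulr_ge0.
  have D0 : 0 <= phi n * Num.sqrt n%:R by rewrite mulr_ge0 ?sqrtr_ge0 // ltW.
  have aE := divfK nt ((t n)%:R * n%:R).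
  (* The squared deviation is [phi n ^+ 2 * n], and its factor [n] cancels against the variance
     bound [5 * n]. *)
  have := bose_einstein_tail R n _ _ _ E n1 aE D0 (fun C => dev _ C aE D0).
  by rewrite exprMn sqr_sqrtr ?ler0n // mulrAC ler_pM2r.
split=> tE; apply: (cvg_inv_sqr phi_pinfty) => n n1 phi0.
  rewrite -bose_einstein_probN ?ger0_norm ?(ltnW n1) //.
  apply: tail => // a C aE D0 CT.
  by apply: (solvable_deviation _ _ _ _ _ _ _ aE D0 CT).1; rewrite ?tE // ltnW.
rewrite sub0r normrN ger0_norm; last exact: be_ge0.
apply: (tail n _ n1 phi0) => a C aE D0 CT.
by apply: (solvable_deviation _ _ _ _ _ _ _ aE D0 CT).2; rewrite ?tE // ltnW.
Qed.
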